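(* Let $U\in\mathbb{R}^{n\times p}$ have orthonormal columns, let $U_{\mathrm{nys}}\in\mathbb{R}^{n\times l}$, let $\widehat\Lambda\in\mathbb{R}^{l\times l}$ be an invertible diagonal matrix, let $\widehat A=U_{\mathrm{nys}}\widehat\Lambda U_{\mathrm{nys}}^\top$, and let $\widehat\lambda_i\in\mathbb{R}$ be nonzero. Put $W=(I-UU^\top)U_{\mathrm{nys}}$ and $M=(I-UU^\top)\widehat A(I-UU^\top)-\widehat\lambda_iI$. If $-\widehat\lambda_i\widehat\Lambda^{-1}+W^\top W$ is invertible, then $M$ is invertible and $$M^{-1}=-\frac{1}{\widehat\lambda_i}I+\frac{1}{\widehat\lambda_i}W\left(-\widehat\lambda_i\widehat\Lambda^{-1}+W^\top W\right)^{-1}W^\top.$$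
   Context: $\widehat A=U_{\mathrm{nys}}\widehat\Lambda U_{\mathrm{nys}}^\top$ is a rank-$l$ (Nyström) approximation of a positive semidefinite matrix given in factored form, $U$ contains previously computed approximate eigenvectors, and $\widehat\lambda_i$ is an eigenvalue estimate. *)

(* Defs.v *)
From mathcomp Require Export all_boot all_order all_algebra.
From mathcomp Require Export reals.

Set Implicit Arguments.
Unset Strict Implicit.
Unset Printing Implicit Defensive.

(* Main.v *)
Require Import Defs.
From mathcomp Require Import all_boot all_order all_algebra.
From mathcomp Require Import reals.

Import GRing.Theory Num.Theory.
Local Open Scope ring_scope.

(* Since [V *m W = S + lam *: L^-1], the term [W *m L *m (V *m W) *m S^-1 *m V]
   of the expanded product equals [W *m L *m V + lam *: (W *m S^-1 *m V)],
   which cancels the other non-scalar terms. *)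
Lemma woodbury_scalar_mulmx (F : fieldType) (n l : nat)
    (W : 'M[F]_(n, l)) (V : 'M[F]_(l, n)) (L : 'M[F]_l) (lam : F) :
  let S := - lam *: invmx L + V *m W in
  L \in unitmx -> lam != 0 -> S \in unitmx ->
  (W *m L *m V - lam *: 1%:M) *m
    (- (1 / lam) *: 1%:M + (1 / lam) *: (W *m invmx S *m V)) = 1%:M.
Proof.
move=> S L_unit lam_neq0 S_unit.
have VW : V *m W = S + lam *: invmx L by rewrite /S scaleNr addrAC addNr add0r.
have WLVWSV : W *m L *m V *m (W *m invmx S *m V)
    = W *m L *m V + lam *: (W *m invmx S *m V).
  (* Once [V *m W] is split, [S] cancels [invmx S] in one summand and [invmx L] cancels [L] in the
     other. *)
  rewrite !mulmxA -(mulmxA (W *m L) V W) VW mulmxDr !mulmxDl -scalemxAr.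
  by rewrite -!scalemxAl mulmxK // mulmxK.
rewrite scaleNr -scalerN -scalerDr -scalemxAr mulmxDr mulmxN mulmx1.
rewrite mulmxBl WLVWSV -scalemxAl mul1mx addrK addrC opprB addrC subrK.
by rewrite scalerA mul1r mulVf // scale1r.
Qed.

(** Over a commutative ring, a one-sided inverse of a square matrix makes it a unit, so [invmx A] is
    a genuine inverse and cancels [A]. *)
Lemma mulmx1_invmx (F : comUnitRingType) (n : nat) (A B : 'M[F]_n) :
  A *m B = 1%:M -> invmx A = B.
Proof.
move=> AB1; have [A_unit _] := mulmx1_unit AB1.
by rewrite -[LHS]mulmx1 -AB1 mulKmx.
Qed.

Theorem lemma2 (R : realType) (n p l : nat)
    (U : 'M[R]_(n, p)) (Unys : 'M[R]_(n, l)) (Lhat : 'M[R]_l) (lam : R)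
    (hU : U^T *m U = 1%:M)
    (hLdiag : is_diag_mx Lhat) (hLunit : Lhat \in unitmx)
    (hlam : lam != 0) :
  let Ahat : 'M[R]_n := Unys *m Lhat *m Unys^T in
  let W : 'M[R]_(n, l) := (1%:M - U *m U^T) *m Unys in
  let M : 'M[R]_n :=
    (1%:M - U *m U^T) *m Ahat *m (1%:M - U *m U^T) - lam *: 1%:M in
  - lam *: invmx Lhat + W^T *m W \in unitmx ->
  M \in unitmx /\
  invmx M =
    - (1 / lam) *: 1%:M
    + (1 / lam) *: (W *m invmx (- lam *: invmx Lhat + W^T *m W) *m W^T).
Proof.
move=> Ahat W M S_unit.
(* The projector [1%:M - U *m U^T] is symmetric, so its two copies around [Ahat] are absorbed into
   [W] and [W^T]; the product identity then applies with [V := W^T]. *)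
have defM : M = W *m Lhat *m W^T - lam *: 1%:M.
  have PT : (1%:M - U *m U^T)^T = 1%:M - U *m U^T.
    by rewrite raddfB /= trmx1 trmx_mul trmxK.
  by rewrite /M /Ahat /W trmx_mul PT !mulmxA.
have MB1 := woodbury_scalar_mulmx _ _ _ _ _ _ _ hLunit hlam S_unit.
rewrite -defM in MB1.
by split; [have [] := mulmx1_unit MB1 | exact: mulmx1_invmx].
Qed.
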